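(* Let $G$ be a matroid on $[n]$ with no loops and no multiple points, $\mathbb{K}$ a field or commutative ring, and let $\preceq$ be a partial order on $[n]$ such that each (nonempty) line-closed set $X$ has a unique smallest element with respect to $\preceq$. Then $\{\bar{a}_S : S\in\operatorname{NBB}(G,\preceq)\}$ is linearly independent in $\bar{A}(G)$.
   Context: $\mathcal{E}$ is the exterior algebra over $\mathbb{K}$ on $e_1,\dots,e_n$; $\partial(e_{i_1}\cdots e_{i_p})=\sum_k(-1)^{k-1}e_{i_1}\cdots\widehat{e_{i_k}}\cdots e_{i_p}$; $\mathcal{I}$ is the ideal generated by $\partial e_S$ for $S$ dependent in $G$; $\mathcal{J}$ is the ideal generated by the degree-two component of $\mathcal{I}$; $\bar{A}(G)=\mathcal{E}/\mathcal{J}$ and $\bar{a}_S$ is the image of $e_S$ (well defined up to sign). $S$ is line-closed if $\operatorname{cl}(\{i,j\})\subseteq S$ for all $i,j\in S$ ($\operatorname{cl}$ = matroid closure); $\operatorname{lc}(S)$ is the intersection of the line-closed sets containing $S$; $\bar{L}(G)$ is the lattice of line-closed sets, join $X\vee Y=\operatorname{lc}(X\cup Y)$, atoms the singletons identified with $[n]$. A set $T\subseteq[n]$ is bounded below (w.r.t. $\preceq$) if there is an atom $a$ with $\{a\}<\operatorname{lc}(T)$ in $\bar L(G)$ and $a\prec t$ for all $t\in T$; $\operatorname{NBB}(G,\preceq)$ is the collection of subsets $S\subseteq[n]$ containing no bounded-below subset. *)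

(* Defs.v *)
From HB Require Import structures.
From mathcomp Require Import all_boot all_order all_algebra.
From mathcomp Require Import boolp.

Set Implicit Arguments.
Unset Strict Implicit.
Unset Printing Implicit Defensive.

Import GRing.Theory.
Local Open Scope ring_scope.
Local Open Scope quotient_scope.

Record matroid (T : finType) := Matroid {
  indep : {set {set T}};
  indep0 : set0 \in indep;
  indepS : forall A B : {set T}, A \subset B -> B \in indep -> A \in indep;
  indep_aug : forall A B : {set T}, A \in indep -> B \in indep ->
    (#|A| < #|B|)%N -> exists2 x, x \in B :\: A & x |: A \in indep
}.

Section MatroidDefs.
Variables (T : finType) (G : matroid T).
Implicit Types S X : {set T}.

Definition dependent S : bool := S \notin indep G.

Definition rank S : nat := (\max_(I in indep G | I \subset S) #|I|)%N.

Definition closure S : {set T} := [set x | rank (x |: S) == rank S].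

Definition no_loops : Prop := forall i : T, ~~ dependent [set i].

Definition no_multiple_points : Prop :=
  forall i j : T, i != j -> ~~ dependent [set i; j].

Definition line_closed S : bool :=
  [forall i in S, forall j in S, closure [set i; j] \subset S].

Definition lc S : {set T} := \bigcap_(X | line_closed X && (S \subset X)) X.

(* The lattice of line-closed sets is ordered by inclusion, and a : T stands
   for its atom [set a]. *)
Definition bounded_below (le : rel T) (S : {set T}) : bool :=
  [exists a, ([set a] \proper lc S) && [forall t in S, (a != t) && le a t]].

Definition NBB (le : rel T) : {set {set T}} :=
  [set S : {set T} | [forall X : {set T}, (X \subset S) ==> ~~ bounded_below le X]].

End MatroidDefs.

(* The free K-module on the e_S, S \subset [n], where e_S is the product of the
   e_i, i \in S, in increasing order; an element is its coefficient family. *)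
Definition exterior (K : comPzRingType) (n : nat) : Type :=
  {ffun {set 'I_n} -> K^o}.

HB.instance Definition _ (K : comPzRingType) (n : nat) :=
  GRing.Lmodule.copy (exterior K n) {ffun {set 'I_n} -> K^o}.

Section ExteriorAlgebra.
Variables (K : comPzRingType) (n : nat).
Local Notation E := (exterior K n).
Implicit Types (x y z : E) (S T W : {set 'I_n}).

Definition coef x S : K := (x : {ffun {set 'I_n} -> K^o}) S.

Definition ebasis S : E := [ffun T => (T == S)%:R].

(* The number of transpositions needed to sort the concatenation of the
   increasing words of S and T. *)
Definition inversions S T : nat := (\sum_(i in S) \sum_(j in T) (j < i))%N.

Definition ext_mul x y : E :=
  [ffun W : {set 'I_n} => \sum_(S : {set 'I_n} | S \subset W)
     (-1) ^+ inversions S (W :\: S) * (coef x S * coef y (W :\: S))].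

Lemma extP x y : coef x =1 coef y -> x = y.
Proof. by move=> h; apply/ffunP => S; apply: h. Qed.

Lemma coefD x y S : coef (x + y) S = coef x S + coef y S.
Proof. by rewrite /coef ffunE. Qed.

Lemma coefZ (a : K) x S : coef (a *: x) S = a * coef x S.
Proof. by rewrite /coef ffunE. Qed.

Lemma coef_basis S T : coef (ebasis S) T = (T == S)%:R.
Proof. by rewrite /coef ffunE. Qed.

Lemma coef_mul x y W : coef (ext_mul x y) W =
  \sum_(S : {set 'I_n} | S \subset W)
     (-1) ^+ inversions S (W :\: S) * (coef x S * coef y (W :\: S)).
Proof. by rewrite /coef ffunE. Qed.

Lemma inversions0s S : inversions set0 S = 0%N.
Proof. by rewrite /inversions big_set0. Qed.

Lemma inversionss0 S : inversions S set0 = 0%N.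
Proof. by rewrite /inversions big1 // => i _; rewrite big_set0. Qed.

Lemma sum_setU S T (F : 'I_n -> nat) : [disjoint S & T] ->
  (\sum_(i in S :|: T) F i = \sum_(i in S) F i + \sum_(i in T) F i)%N.
Proof.
move=> dST; rewrite -bigU //=; apply: eq_bigl => i.
by rewrite !inE.
Qed.

Lemma inversionsUl S T W : [disjoint S & T] ->
  inversions (S :|: T) W = (inversions S W + inversions T W)%N.
Proof. exact: sum_setU. Qed.

Lemma inversionsUr S T W : [disjoint T & W] ->
  inversions S (T :|: W) = (inversions S T + inversions S W)%N.
Proof.
move=> dTW; rewrite /inversions -big_split /=.
by apply: eq_bigr => i _; rewrite -sum_setU.
Qed.

Fact ext_mulDl : left_distributive ext_mul +%R.
Proof.
move=> x y z; apply: extP => W; rewrite coefD !coef_mul -big_split /=.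
by apply: eq_bigr => S _; rewrite coefD mulrDl mulrDr.
Qed.

Fact ext_mulDr : right_distributive ext_mul +%R.
Proof.
move=> x y z; apply: extP => W; rewrite coefD !coef_mul -big_split /=.
by apply: eq_bigr => S _; rewrite coefD !mulrDr.
Qed.

Fact ext_mul1l : left_id (ebasis set0) ext_mul.
Proof.
move=> x; apply: extP => W; rewrite coef_mul (bigD1 set0) ?sub0set //=.
rewrite big1 => [|S /andP[_ /negPf nS]].
  by rewrite coef_basis eqxx setD0 inversions0s !mul1r addr0.
by rewrite coef_basis nS mul0r mulr0.
Qed.

Fact ext_mul1r : right_id (ebasis set0) ext_mul.
Proof.
move=> x; apply: extP => W; rewrite coef_mul (bigD1 W) //=.
rewrite big1 => [|S /andP[sSW nS]].
  by rewrite coef_basis setDv eqxx inversionss0 mulr1 mul1r addr0.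
rewrite coef_basis setD_eq0 (_ : W \subset S = false) ?mulr0 //.
by apply: contraNF nS => sWS; rewrite eqEsubset sSW.
Qed.

Fact ext_mulA : associative ext_mul.
Proof.
move=> x y z; apply: extP => W; rewrite !coef_mul.
pose t (R Q U : {set 'I_n}) : K :=
  (-1) ^+ (inversions R Q + inversions R U + inversions Q U)
  * (coef x R * coef y Q * coef z U).
transitivity (\sum_(R : {set 'I_n} | R \subset W)
  \sum_(Q : {set 'I_n} | Q \subset W :\: R) t R Q (W :\: R :\: Q)).
  apply: eq_bigr => R sRW; rewrite coef_mul !mulr_sumr.
  apply: eq_bigr => Q sQW.
  have dQ : [disjoint Q & W :\: R :\: Q].
    by rewrite disjoints_subset setCD subsetUr.
  rewrite -[X in inversions R X](setID (W :\: R) Q).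
  rewrite (setIidPr sQW) inversionsUr // !exprD /t !exprD.
  rewrite -!mulrA. 
  by do 2!congr (_ * _); rewrite mulrCA.
transitivity (\sum_(S : {set 'I_n} | S \subset W)
  \sum_(R : {set 'I_n} | R \subset S) t R (S :\: R) (W :\: S)); last first.
  apply: eq_bigr => S sSW; rewrite coef_mul mulr_suml mulr_sumr.
  apply: eq_bigr => R sRS.
  have dR : [disjoint R & S :\: R] by rewrite disjoints_subset setCD subsetUr.
  rewrite -[X in inversions X (W :\: S)](setID S R).
  rewrite (setIidPr sRS) inversionsUl // /t -addnA addnC exprD.
  by rewrite -!mulrA; congr (_ * _).
rewrite [RHS](exchange_big_dep (fun R : {set 'I_n} => R \subset W)) /=; last first.
  by move=> S R sSW sRS; apply: subset_trans sSW.
apply: eq_bigr => R sRW.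
rewrite (reindex_onto (fun S : {set 'I_n} => S :\: R)
                      (fun Q : {set 'I_n} => R :|: Q)) /=; last first.
  move=> Q; rewrite subsetD => /andP[_ dQR]; rewrite setDUl setDv set0U.
  by apply/setDidPl.
apply: eq_big => [S|S /andP[_ /eqP <-]].
  apply/andP/andP => [[sSR /eqP eS]|[sSW sRS]].
    rewrite -eS subsetUl subUset sRW; split=> //.
    exact: subset_trans (subsetDl W R).
  split; first exact: setSD.
  by rewrite -[X in X :|: _](setIidPr sRS) setID.
by rewrite setDDl; congr t; rewrite ?setDUl ?setDv ?set0U ?setDDl ?setUid //;
   rewrite setUC -setUA setUid setUC.
Qed.

HB.instance Definition _ := GRing.Zmodule_isPzRing.Build E
  ext_mulA ext_mul1l ext_mul1r ext_mulDl ext_mulDr.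

Lemma ext_scalerAl (a : K) x y : a *: (x * y) = (a *: x) * y.
Proof.
apply: extP => W; rewrite coefZ !coef_mul mulr_sumr.
by apply: eq_bigr => S _; rewrite coefZ mulrCA -!mulrA.
Qed.

Lemma ext_scalerAr (a : K) x y : a *: (x * y) = x * (a *: y).
Proof.
apply: extP => W; rewrite coefZ !coef_mul mulr_sumr.
by apply: eq_bigr => S _; rewrite coefZ mulrCA; congr (_ * _); rewrite mulrCA.
Qed.

Lemma ebasisM S T : ebasis S * ebasis T =
  if [disjoint S & T] then (-1) ^+ inversions S T *: ebasis (S :|: T) else 0.
Proof.
apply: extP => W; rewrite coef_mul.
have [dST|ndST] := boolP [disjoint S & T]; last first.
  rewrite [RHS](_ : _ = 0) /coef ?ffunE // big1 // => U sUW.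
  rewrite -/(coef _ _) -/(coef _ _) !coef_basis -natrM mulnb.
  case: andP => [[/eqP eU /eqP eT]|_]; last by rewrite mulr0.
  by rewrite -eU -eT -setI_eq0 setIDA setDIl setDv set0I eqxx in ndST.
rewrite coefZ coef_basis; have [->|nW] := eqVneq W (S :|: T).
  rewrite (bigD1 S) ?subsetUl //= big1 => [|U /andP[_ /negPf nU]].
    rewrite addr0 setDUl setDv set0U (setDidPl _) 1?disjoint_sym //.
    by rewrite !coef_basis !eqxx mulr1.
  by rewrite coef_basis nU mul0r mulr0.
rewrite mulr0 big1 // => U sUW; rewrite !coef_basis -natrM mulnb.
case: andP => [[/eqP eU /eqP eT]|_]; last by rewrite mulr0.
by case/eqP: nW; rewrite -eT -eU -[X in X :|: _](setIidPr sUW) setID.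
Qed.

Definition gen (i : 'I_n) : E := ebasis [set i].

Lemma gen_sq i : gen i * gen i = 0.
Proof. by rewrite ebasisM disjoints1 inE eqxx. Qed.

Lemma gen_anticomm i j : gen i * gen j = - (gen j * gen i).
Proof.
have [<-|nij] := eqVneq i j; first by rewrite gen_sq oppr0.
rewrite !ebasisM !disjoints1 !inE (eq_sym j) nij setUC.
rewrite /inversions !big_set1; case: ltngtP => //= [_|_|/val_inj eij].
- by rewrite expr0 expr1 scaleN1r scale1r ?opprK.
- by rewrite expr0 expr1 scaleN1r scale1r ?opprK.
by rewrite eij eqxx in nij.
Qed.

Lemma ebasis_prod S : ebasis S = \prod_(i <- enum S) gen i.
Proof.
have: sorted (fun i j : 'I_n => (i < j)%N) (enum S).
  rewrite {1}/enum_mem.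
  apply: sorted_filter => [i j k|]; first exact: ltn_trans.
  rewrite -enumT -(@sorted_map _ _ (@nat_of_ord n) ltn) val_enum_ord.
  exact: iota_ltn_sorted.
rewrite -[in ebasis S](set_enum S); elim: (enum S) => [|i s IHs] hs.
  by rewrite big_nil -[RHS]/(ebasis set0); congr ebasis.
have his : all (fun j : 'I_n => (i < j)%N) s.
  by apply: (order_path_min _ hs) => j k l; apply: ltn_trans.
rewrite big_cons -IHs; last exact: path_sorted hs.
rewrite /gen ebasisM disjoints1 inE.
have -> : i \notin s by apply/negP => /(allP his); rewrite ltnn.
rewrite /inversions big_set1 big1 => [|j]; last first.
  by rewrite inE => /(allP his)/ltnW; rewrite ltnNge => ->.
by rewrite scale1r; congr ebasis; apply/setP => j; rewrite !inE.
Qed.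

(* The derivation determined by
   del (e_{i_1} ... e_{i_p}) = \sum_k (-1)^(k-1) e_{i_1} .. ^e_{i_k} .. e_{i_p}
   for i_1 < ... < i_p; the exponent k - 1 is the number of j in S below i_k. *)
Definition del x : E :=
  \sum_(S : {set 'I_n}) coef x S *:
    \sum_(i in S) (-1) ^+ #|[set j in S | (j < i)%N]| *: ebasis (S :\ i).

Lemma del_basis S : del (ebasis S) =
  \sum_(i in S) (-1) ^+ #|[set j in S | (j < i)%N]| *: ebasis (S :\ i).
Proof.
rewrite /del (bigD1 S) //= [X in _ + X]big1 => [|T /negPf nT].
  by rewrite coef_basis eqxx scale1r addr0.
by rewrite coef_basis nT scale0r.
Qed.

Definition homogeneous (d : nat) x : Prop :=
  forall S, coef x S != 0 -> #|S| = d.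

End ExteriorAlgebra.

Arguments ebasis K {n} S.

Definition two_sided_ideal (R : pzRingType) (I : R -> Prop) : Prop :=
  [/\ I 0, forall x y, I x -> I y -> I (x - y),
      forall a x, I x -> I (a * x) & forall a x, I x -> I (x * a)].

Definition ideal_gen (R : pzRingType) (P : R -> Prop) (x : R) : Prop :=
  forall I : R -> Prop, two_sided_ideal I -> (forall y, P y -> I y) -> I x.

Lemma ideal_gen_ideal (R : pzRingType) (P : R -> Prop) :
  two_sided_ideal (ideal_gen P).
Proof.
split=> [|x y hx hy|a x hx|a x hx] I hI hP; case: (hI) => I0 IB Il Ir //.
- by apply: IB; [apply: hx|apply: hy].
- by apply: Il; apply: hx.
- by apply: Ir; apply: hx.
Qed.

Definition idealb (R : pzRingType) (P : R -> Prop) : {pred R} :=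
  fun x => `[< ideal_gen P x >].

Lemma idealbP (R : pzRingType) (P : R -> Prop) x :
  reflect (ideal_gen P x) (x \in idealb P).
Proof. exact: asboolP. Qed.

Fact idealb_zmod_closed (R : pzRingType) (P : R -> Prop) :
  zmod_closed (idealb P).
Proof.
have [I0 IB _ _] := ideal_gen_ideal P.
split=> [|x y /idealbP hx /idealbP hy]; apply/idealbP => //; exact: IB.
Qed.

HB.instance Definition _ (R : pzRingType) (P : R -> Prop) :=
  GRing.isZmodClosed.Build R (idealb P) (idealb_zmod_closed P).

(* The ideal is made boolean by classical choice, as Quotient.quot requires. *)
Definition ext_quot (K : comPzRingType) (n : nat) (P : exterior K n -> Prop) :
  Type := Quotient.quot (idealb P).

HB.instance Definition _ (K : comPzRingType) (n : nat)
    (P : exterior K n -> Prop) := GRing.Zmodule.on (ext_quot P).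

Section ExteriorQuotient.
Variables (K : comPzRingType) (n : nat) (P : exterior K n -> Prop).
Local Notation E := (exterior K n).
Local Notation Q := (ext_quot P).
Implicit Types (x y : E) (u v w : Q).

Definition ext_pi x : Q := \pi_(Quotient.quot (idealb P)) x.
Definition ext_repr u : E := repr (u : Quotient.quot (idealb P)).

Lemma ext_reprK u : ext_pi (ext_repr u) = u.
Proof. exact: reprK. Qed.

Lemma ext_piP x y : ext_pi x = ext_pi y <-> ideal_gen P (x - y).
Proof.
split=> [/eqP|h]; first by rewrite -Quotient.idealrBE => /idealbP.
by apply/eqP; rewrite -Quotient.idealrBE; apply/idealbP.
Qed.

Lemma ext_pi_repr x : ideal_gen P (ext_repr (ext_pi x) - x).
Proof. by apply/ext_piP; rewrite ext_reprK. Qed.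

Lemma ext_piD x y : ext_pi (x + y) = ext_pi x + ext_pi y.
Proof. exact: (@Quotient.pi_add E (idealb P)). Qed.

Definition ext_quot_mul u v : Q := ext_pi (ext_repr u * ext_repr v).
Definition ext_quot_scale (a : K) u : Q := ext_pi (a *: ext_repr u).

Lemma ext_pi_mul x y : ext_quot_mul (ext_pi x) (ext_pi y) = ext_pi (x * y).
Proof.
have [_ IB Il Ir] := ideal_gen_ideal P.
apply/ext_piP; set x' := ext_repr _; set y' := ext_repr _.
have -> : x' * y' - x * y = (x' - x) * y' - x * (y - y').
  by rewrite mulrBl mulrBr opprB addrA subrK.
apply: IB; first by apply: Ir; apply: ext_pi_repr.
by apply: Il; apply/ext_piP; rewrite ext_reprK.
Qed.

Lemma ext_pi_scale (a : K) x : ext_quot_scale a (ext_pi x) = ext_pi (a *: x).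
Proof.
have [_ _ Il _] := ideal_gen_ideal P.
apply/ext_piP; rewrite -scalerBr -[X in a *: X]mul1r ext_scalerAl.
by apply: Il; apply: ext_pi_repr.
Qed.

Fact ext_quot_mulA : associative ext_quot_mul.
Proof.
move=> u v w; rewrite -[u]ext_reprK -[v]ext_reprK -[w]ext_reprK.
by rewrite !ext_pi_mul mulrA.
Qed.

Fact ext_quot_mul1l : left_id (ext_pi 1) ext_quot_mul.
Proof. by move=> u; rewrite -[u]ext_reprK ext_pi_mul mul1r. Qed.

Fact ext_quot_mul1r : right_id (ext_pi 1) ext_quot_mul.
Proof. by move=> u; rewrite -[u]ext_reprK ext_pi_mul mulr1. Qed.

Fact ext_quot_mulDl : left_distributive ext_quot_mul +%R.
Proof.
move=> u v w; rewrite -[u]ext_reprK -[v]ext_reprK -[w]ext_reprK.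
by rewrite -ext_piD !ext_pi_mul mulrDl ext_piD.
Qed.

Fact ext_quot_mulDr : right_distributive ext_quot_mul +%R.
Proof.
move=> u v w; rewrite -[u]ext_reprK -[v]ext_reprK -[w]ext_reprK.
by rewrite -ext_piD !ext_pi_mul mulrDr ext_piD.
Qed.

HB.instance Definition _ := GRing.Zmodule_isPzRing.Build Q
  ext_quot_mulA ext_quot_mul1l ext_quot_mul1r ext_quot_mulDl ext_quot_mulDr.

Fact ext_quot_scalerA (a b : K) u :
  ext_quot_scale a (ext_quot_scale b u) = ext_quot_scale (a * b) u.
Proof. by rewrite -[u]ext_reprK !ext_pi_scale scalerA. Qed.

Fact ext_quot_scale1r : left_id 1 ext_quot_scale.
Proof. by move=> u; rewrite -[u]ext_reprK ext_pi_scale scale1r. Qed.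

Fact ext_quot_scalerDr : right_distributive ext_quot_scale +%R.
Proof.
move=> a u v; rewrite -[u]ext_reprK -[v]ext_reprK.
by rewrite -ext_piD !ext_pi_scale scalerDr ext_piD.
Qed.

Fact ext_quot_scalerDl u : {morph ext_quot_scale^~ u : a b / a + b}.
Proof.
move=> a b; rewrite -[u]ext_reprK !ext_pi_scale.
by rewrite scalerDl ext_piD.
Qed.

HB.instance Definition _ := GRing.Zmodule_isLmodule.Build K Q
  ext_quot_scalerA ext_quot_scale1r ext_quot_scalerDr ext_quot_scalerDl.

Lemma ext_piM x y : ext_pi (x * y) = ext_pi x * ext_pi y.
Proof. by rewrite -ext_pi_mul. Qed.

Lemma ext_piZ (a : K) x : ext_pi (a *: x) = a *: ext_pi x.
Proof. by rewrite -ext_pi_scale. Qed.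

End ExteriorQuotient.

Section QuadraticOS.
Variables (K : comPzRingType) (n : nat) (G : matroid 'I_n).

Definition OS_ideal : exterior K n -> Prop :=
  ideal_gen (fun x => exists2 S, dependent G S & x = del (ebasis K S)).

(* OS_ideal is generated by homogeneous elements, so its component of degree
   two is its intersection with the homogeneous elements of degree two. *)
Definition quadratic_relation (x : exterior K n) : Prop :=
  OS_ideal x /\ homogeneous 2 x.

Definition quadratic_OS : Type := ext_quot quadratic_relation.

HB.instance Definition _ := GRing.PzRing.on quadratic_OS.
HB.instance Definition _ := GRing.Lmodule.on quadratic_OS.

Definition abar (S : {set 'I_n}) : quadratic_OS :=
  ext_pi quadratic_relation (ebasis K S).

End QuadraticOS.

Definition lin_indep (K : pzRingType) (V : lmodType K) (I : finType)
    (A : {set I}) (v : I -> V) : Prop :=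
  forall c : I -> K, \sum_(i in A) c i *: v i = 0 -> forall i, i \in A -> c i = 0.

(* Main.v *)
(* The relations of degree two are spanned by the boundaries of the dependent
   triples, which are central cycles, so the ideal they generate is stable under
   the derivation del and graded by line-closure: dropping one element of a
   dependent triple {i, j, k} does not change lc (T :|: {i, j, k}).  Projecting
   to a graded piece and applying del, repeatedly, thus yields linear forms that
   vanish on the ideal, one for each sequence of line-closed sets.  A nonempty
   NBB set S contains the smallest element a of lc S, so among the terms e_(T\i)
   of del e_T with T NBB and lc T = lc S, only T\a can equal S\a; by induction on
   S the form of the sequence lc S, lc (S\a), ... is +1 or -1 at e_S and 0 at the
   other NBB monomials. *)
From HB Require Import structures.
From mathcomp Require Import all_boot all_order all_algebra.
Require Import Defs.

Set Implicit Arguments.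
Unset Strict Implicit.
Unset Printing Implicit Defensive.

Import GRing.Theory.
Local Open Scope ring_scope.

(** * The derivation [del], and central elements of the exterior algebra *)

Section Exterior.
Variables (K : comPzRingType) (n : nat).
Local Notation E := (exterior K n).
Implicit Types (x y z r : E) (S T W X : {set 'I_n}) (F : seq {set 'I_n}).

Lemma coef_sum (I : Type) (s : seq I) (P : pred I) (f : I -> E) S :
  coef (\sum_(i <- s | P i) f i) S = \sum_(i <- s | P i) coef (f i) S.
Proof.
apply: (big_morph (fun x : E => coef x S)) => [x y|]; first exact: coefD.
by rewrite /coef ffunE.
Qed.

Lemma ebasis_decomp x : x = \sum_S coef x S *: ebasis K S.
Proof.
apply: extP => W; rewrite coef_sum (bigD1 W) //= big1 => [|S /negPf nS].
  by rewrite coefZ coef_basis eqxx mulr1 addr0.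
by rewrite coefZ coef_basis eq_sym nS mulr0.
Qed.

Fact del_is_linear : linear (@del K n).
Proof.
move=> a x y; rewrite /del scaler_sumr -big_split /=.
by apply: eq_bigr => S _; rewrite coefD coefZ scalerDl scalerA.
Qed.
HB.instance Definition _ :=
  GRing.isLinear.Build K E E *:%R (@del K n) del_is_linear.

(** Every monomial is a product of generators, so identities for [del] only need to be checked under
    left multiplication by one generator. *)
Lemma exterior_ind (P : E -> Prop) :
  P 1 -> (forall x y, P x -> P y -> P (x + y)) ->
  (forall (a : K) x, P x -> P (a *: x)) ->
  (forall i x, P x -> P (gen K i * x)) -> forall x, P x.
Proof.
move=> P1 PD PZ Pg x; rewrite [x]ebasis_decomp.
have Pb S : P (ebasis K S).
  rewrite ebasis_prod; elim: (enum S) => [|i s IHs]; first by rewrite big_nil.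
  by rewrite big_cons; apply: Pg.
elim/big_ind: _ => [|//|S _]; last by apply: PZ.
by rewrite -(scale0r (1 : E)); apply: PZ.
Qed.

Lemma eq_sign_odd (p q : nat) : odd p = odd q -> (-1) ^+ p = (-1) ^+ q :> K.
Proof. by move=> e; rewrite -signr_odd e signr_odd. Qed.

Lemma inversions1s i S : inversions [set i] S = #|[set j in S | (j < i)%N]|.
Proof.
rewrite /inversions big_set1 -sum1_card big_mkcond [RHS]big_mkcond /=.
by apply: eq_bigr => j _; rewrite !inE; case: (j \in S); case: ltnP.
Qed.

Lemma genM i S : gen K i * ebasis K S =
  if i \in S then 0 else
  (-1) ^+ #|[set j in S | (j < i)%N]| *: ebasis K (i |: S).
Proof. by rewrite ebasisM disjoints1 inversions1s; case: (i \in S). Qed.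

Lemma card_below_setU1 (i j : 'I_n) S : i \notin S ->
  #|[set k in i |: S | (k < j)%N]| =
  ((i < j) + #|[set k in S | (k < j)%N]|)%N.
Proof.
move=> iS; rewrite -!inversions1s inversionsUr ?disjoints1 //.
by congr (_ + _)%N; rewrite /inversions !big_set1.
Qed.

Lemma card_below_setD1 (i j : 'I_n) S : i \in S ->
  #|[set k in S | (k < j)%N]| =
  ((i < j) + #|[set k in S :\ i | (k < j)%N]|)%N.
Proof.
by move=> iS; rewrite -card_below_setU1 ?setD1K // !inE eqxx.
Qed.

(** The Leibniz rule for a factor of degree one. By linearity it is a comparison of signs on each
    monomial. *)
Lemma del_genM i x : del (gen K i * x) = x - gen K i * del x.
Proof.
rewrite [x]ebasis_decomp mulr_sumr !linear_sum /= mulr_sumr.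
rewrite -sumrB; apply: eq_bigr => S _.
rewrite -ext_scalerAr !linearZ /= -ext_scalerAr -scalerBr; congr (_ *: _).
rewrite genM del_basis mulr_sumr.
(* If [i] is in [S], the product on the left is zero; on the right only the term removing [i]
   survives, with squared sign, and it cancels [ebasis K S]. *)
have [iS|iS] := boolP (i \in S).
  rewrite (bigD1 i) //= big1 => [|j /andP[jS nji]]; last first.
    by rewrite -ext_scalerAr genM !inE eq_sym nji iS scaler0.
  rewrite -ext_scalerAr genM !inE eqxx /= setD1K // scalerA.
  rewrite (card_below_setD1 i iS) ltnn add0n -exprD addnn -signr_odd odd_double.
  by rewrite scale1r addr0 subrr raddf0.
rewrite linearZ /= del_basis big_setU1 //= scalerDr; congr (_ + _).
  rewrite scalerA setU1K // card_below_setU1 // ltnn add0n -exprD addnn.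
  by rewrite -signr_odd odd_double scale1r.
rewrite scaler_sumr -sumrN; apply: eq_bigr => j jS.
have nij : i != j by apply: contraNneq iS => ->.
rewrite -ext_scalerAr genM !inE nij (negPf iS) /= !scalerA -scaleNr.
rewrite card_below_setU1 // (card_below_setD1 i jS).
have -> : (i |: S) :\ j = i |: S :\ j.
  apply/setP => k; rewrite !inE; case: eqVneq => [->|] //.
  by rewrite eq_sym (negPf nij).
(* Exactly one of [i < j] and [j < i] holds, which accounts for the extra minus sign. *)
congr (_ *: _); rewrite -mulNr -[- _ ^+ _]mulN1r -exprS -!exprD.
apply: eq_sign_odd; rewrite /= !oddD.
have : (i != j :> nat) by [].
by case: ltngtP => // _ _ /=; case: (odd #|_|); case: (odd #|_|).
Qed.

Lemma del1 : del (1 : E) = 0.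
Proof. by rewrite -[1]/(ebasis K set0) del_basis big_set0. Qed.

Lemma del_del x : del (del x) = 0.
Proof.
elim/exterior_ind: x => [|x y hx hy|a x hx|i x hx].
- by rewrite del1 linear0.
- by rewrite !linearD /= hx hy addr0.
- by rewrite !linearZ /= hx scaler0.
by rewrite del_genM linearB /= del_genM hx mulr0 subr0 subrr.
Qed.

(** In the Leibniz rule the sign depending on the degree of [x] sits on the term with [del r], which
    vanishes here; hence [x] may be inhomogeneous. *)
Lemma delM_cycle x r : del r = 0 -> del (x * r) = del x * r.
Proof.
move=> r0; elim/exterior_ind: x => [|x y hx hy|a x hx|i x hx].
- by rewrite mul1r r0 del1 mul0r.
- by rewrite mulrDl !linearD /= mulrDl hx hy.
- by rewrite -ext_scalerAl !linearZ /= hx -ext_scalerAl.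
by rewrite -mulrA !del_genM hx mulrBl mulrA.
Qed.

Lemma inversions_sym S T : [disjoint S & T] ->
  (inversions S T + inversions T S = #|S| * #|T|)%N.
Proof.
move=> dST; rewrite /inversions [in X in (_ + X)%N]exchange_big -big_split /=.
rewrite -sum_nat_const; apply: eq_bigr => i iS.
rewrite -big_split -sum1_card /=; apply: eq_bigr => j jT.
have : (i != j :> nat).
  by apply: contraTneq jT => /val_inj <-; rewrite (disjointFr dST iS).
by case: ltngtP.
Qed.

(** Exchanging two disjoint monomials costs a sign with exponent [#|S| * #|T|], which is even. *)
Lemma ebasis_even_central S x : ~~ odd #|S| -> ebasis K S * x = x * ebasis K S.
Proof.
move=> eS; rewrite [x]ebasis_decomp mulr_sumr mulr_suml.
apply: eq_bigr => T _; rewrite -ext_scalerAr -ext_scalerAl; congr (_ *: _).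
rewrite !ebasisM disjoint_sym setUC; case: ifPn => // dTS; congr (_ *: _).
apply: eq_sign_odd; have := congr1 odd (inversions_sym dTS).
by rewrite oddM (negPf eS) ?andbF oddD; do 2!case: (odd (inversions _ _)).
Qed.

Lemma coef_del_basis S W :
  coef (del (ebasis K S)) W != 0 -> exists2 i, i \in S & W = S :\ i.
Proof.
move=> nz; suff /exists_inP[i iS /eqP eW] : [exists i in S, W == S :\ i].
  by exists i.
apply: contraNT nz => /exists_inPn h.
rewrite del_basis coef_sum big1 // => i iS.
by rewrite coefZ coef_basis (negPf (h i iS)) mulr0.
Qed.

Lemma del_central S x : odd #|S| ->
  del (ebasis K S) * x = x * del (ebasis K S).
Proof.
move=> oS; rewrite del_basis mulr_suml mulr_sumr; apply: eq_bigr => i iS.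
rewrite -ext_scalerAl -ext_scalerAr ebasis_even_central //.
by move: oS; rewrite (cardsD1 i) iS.
Qed.

End Exterior.

(** * The grading by line closure and the forms attached to flags *)

Section Flags.
Variables (K : comPzRingType) (n : nat) (G : matroid 'I_n).
Local Notation E := (exterior K n).
Implicit Types (x y z r : E) (S T W X : {set 'I_n}) (F : seq {set 'I_n}).

Lemma lc_closed S : line_closed G (lc G S).
Proof.
apply/forall_inP => i /bigcapP iS; apply/forall_inP => j /bigcapP jS.
apply/bigcapsP => X hX; have [/forall_inP lX _] := andP hX.
exact: (forall_inP (lX i (iS X hX)) j (jS X hX)).
Qed.

Lemma sub_lc S : S \subset lc G S.
Proof. by apply/bigcapsP => X /andP[]. Qed.

Lemma lc_min S X : line_closed G X -> S \subset X -> lc G S \subset X.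
Proof. by move=> lX sSX; apply: bigcap_inf; rewrite lX. Qed.

Definition lc_part X x : E := [ffun W => if lc G W == X then coef x W else 0].

Lemma coef_lc_part X x W :
  coef (lc_part X x) W = if lc G W == X then coef x W else 0.
Proof. by rewrite /coef ffunE. Qed.

Fact lc_part_is_linear X : linear (lc_part X).
Proof.
move=> a x y; apply: extP => W; rewrite coefD coefZ !coef_lc_part.
by case: ifP; rewrite ?coefD ?coefZ // mulr0 addr0.
Qed.
HB.instance Definition _ X :=
  GRing.isLinear.Build K E E *:%R (lc_part X) (lc_part_is_linear X).

Lemma lc_part_homogeneous X Y x :
  (forall W, coef x W != 0 -> lc G W = Y) ->
  lc_part X x = if X == Y then x else 0.
Proof.
move=> hx; apply: extP => W; rewrite coef_lc_part.
have [x0|/hx ->] := eqVneq (coef x W) 0; last first.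
  by rewrite eq_sym; case: ifP => // _; rewrite /coef ffunE.
by rewrite x0 if_same; case: ifP => // _; rewrite /coef ffunE.
Qed.

(* On [ebasis S] this is the signed count of the orderings i_1, ..., i_p of S
   such that F is the sequence of the lc {i_k, ..., i_p}, k = 1, ..., p. *)
Fixpoint flag_form F x : K^o :=
  if F is X :: F' then flag_form F' (del (lc_part X x)) else coef x set0.

Fact flag_form_is_linear F : linear (flag_form F).
Proof.
elim: F => [|X F IHF] a x y /=; first by rewrite coefD coefZ.
by rewrite !linearP /= IHF.
Qed.
HB.instance Definition _ F :=
  GRing.isLinear.Build K E K^o *:%R (flag_form F) (flag_form_is_linear F).

Lemma lc_part_basis X S :
  lc_part X (ebasis K S) = if X == lc G S then ebasis K S else 0.
Proof.
apply: lc_part_homogeneous => W; rewrite coef_basis.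
by case: (W =P S) => [->//|_]; rewrite eqxx.
Qed.

Lemma flag_form_basis X F S : flag_form (X :: F) (ebasis K S) =
  if X == lc G S then
    \sum_(i in S) (-1) ^+ #|[set j in S | (j < i)%N]|
       * flag_form F (ebasis K (S :\ i))
  else 0.
Proof.
rewrite /= lc_part_basis; case: ifP => _; last by rewrite !linear0.
rewrite del_basis linear_sum; apply: eq_bigr => i _.
by rewrite linearZ.
Qed.

(** * Dependent triples, and vanishing of the forms on their boundaries *)

Hypothesis simple_pts : no_loops G.
Hypothesis simple_lines : no_multiple_points G.

Lemma dependent_card S : dependent G S -> (2 < #|S|)%N.
Proof.
move=> dS; rewrite ltnNge leq_eqVlt ltnS leq_eqVlt ltnS leqn0 cards_eq0.
apply/negP => /or3P[/cards2P[i [j [nij eS]]]|/cards1P[i eS]|/eqP eS].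
- by have := simple_lines nij; rewrite -eS dS.
- by have := simple_pts i; rewrite -eS dS.
by move: dS; rewrite eS /dependent indep0.
Qed.

(** The pair [S :\ i] is independent because [G] is simple, and [S] is dependent of size three, so
    both have rank two. *)
Lemma dependent3_closure S i : dependent G S -> #|S| = 3%N -> i \in S ->
  i \in closure G (S :\ i).
Proof.
move=> dS S3 iS; rewrite inE setD1K // eqn_leq; apply/andP; split; last first.
  apply/bigmax_leqP => I /andP[hI sI]; apply: leq_bigmax_cond.
  by rewrite hI (subset_trans sI) ?subD1set.
have cS : #|S :\ i| = 2%N by move: S3; rewrite (cardsD1 i) iS add1n => -[].
have iD : S :\ i \in indep G.
  by apply/negPn/negP => /dependent_card; rewrite cS.
apply: (@leq_trans 2).
  apply/bigmax_leqP => I /andP[hI sI]; rewrite -ltnS -S3; apply: proper_card.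
  by rewrite properEneq sI andbT; apply: contraNneq dS => <-.
by rewrite -{1}cS; apply: leq_bigmax_cond; rewrite iD subxx.
Qed.

(** The dropped point lies on the line through the other two, which every line-closed set containing
    them includes. *)
Lemma lc_drop_dependent T S i : dependent G S -> #|S| = 3%N -> i \in S ->
  lc G (T :|: S :\ i) = lc G (T :|: S).
Proof.
move=> dS S3 iS; apply/eqP; rewrite eqEsubset; apply/andP; split.
  apply: lc_min (lc_closed _) _; apply: subset_trans (sub_lc _).
  by rewrite setUS ?subD1set.
apply: lc_min (lc_closed _) _; set L := lc G _.
have : T :|: S :\ i \subset L by apply: sub_lc.
rewrite !subUset => /andP[-> sL] /=; rewrite -(setD1K iS) subUset sL andbT.
have cS : #|S :\ i| == 2%N by move: S3; rewrite (cardsD1 i) iS add1n => -[->].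
have := dependent3_closure dS S3 iS.
have /cards2P[j [k [njk eS]]] := cS; rewrite eS => icl.
move: sL; rewrite eS subUset !sub1set => /andP[jL kL].
have /forall_inP/(_ j jL)/forall_inP/(_ k kL)/subsetP :=
  lc_closed (T :|: S :\ i).
by apply.
Qed.

Lemma coef_basisM_del T S W : dependent G S -> #|S| = 3%N ->
  coef (ebasis K T * del (ebasis K S)) W != 0 -> lc G W = lc G (T :|: S).
Proof.
move=> dS S3; apply: contraNeq => nW; rewrite del_basis mulr_sumr coef_sum.
rewrite big1 // => i iS; rewrite -ext_scalerAr coefZ ebasisM.
case: ifP => _; last by rewrite /coef ffunE mulr0.
rewrite coefZ coef_basis; case: eqP => [eW|_]; last by rewrite !mulr0.
by rewrite eW lc_drop_dependent ?eqxx in nW.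
Qed.

(** The multiples of [del (ebasis K S)] are stable under both operations of the recursion: [lc_part]
    keeps or kills each product with a monomial, and [del] acts on the left factor alone. At the end
    of the flag, a boundary of degree two has no constant term. *)
Lemma flag_form_ideal F y S : dependent G S -> #|S| = 3%N ->
  flag_form F (y * del (ebasis K S)) = 0.
Proof.
move=> dS S3; elim: F y => [|X F IHF] y.
  rewrite /= coef_mul big1 // => W _; rewrite set0D.
  have [->|/coef_del_basis[i iS e0]] := eqVneq (coef (del (ebasis K S)) set0) 0.
    by rewrite !mulr0.
  by move: S3; rewrite (cardsD1 i) iS -e0 cards0.
rewrite [y]ebasis_decomp mulr_suml linear_sum big1 // => T _.
rewrite -ext_scalerAl linearZ /=.
rewrite (lc_part_homogeneous X (fun W => coef_basisM_del dS S3)).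
case: ifP => _; last by rewrite !linear0.
by rewrite delM_cycle ?del_del // IHF scaler0.
Qed.

(** * Generators of the ideal of quadratic relations *)

Lemma OS_ideal_degree_le2 x : OS_ideal G x -> exists c : {set 'I_n} -> K,
  forall W, (#|W| <= 2)%N -> coef x W =
    \sum_(S | dependent G S && (#|S| == 3%N)) c S * coef (del (ebasis K S)) W.
Proof.
(* The elements satisfying [low] form a two-sided ideal containing all generators, hence contain
   [OS_ideal G]. *)
pose low x := exists c : {set 'I_n} -> K, forall W, (#|W| <= 2)%N ->
  coef x W =
    \sum_(S | dependent G S && (#|S| == 3%N)) c S * coef (del (ebasis K S)) W.
have low_small z W : low z -> (#|W| < 2)%N -> coef z W = 0.
  move=> [c hc] W2; rewrite hc 1?ltnW // big1 // => S /andP[_ /eqP S3].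
  have [->|/coef_del_basis[i iS eW]] :=
    eqVneq (coef (del (ebasis K S)) W) 0; first by rewrite mulr0.
  by move: S3 W2; rewrite (cardsD1 i) iS -eW add1n => -[->].
have scale a z z' : low z ->
    (forall W, (#|W| <= 2)%N -> coef z' W = a * coef z W) -> low z'.
  move=> [c hc] hz; exists (fun S => a * c S) => W W2; rewrite hz // hc //.
  by rewrite mulr_sumr; apply: eq_bigr => S _; rewrite mulrA.
move/(_ low); apply; first split.
- exists (fun=> 0) => W _; rewrite big1 => [|S _]; last by rewrite mul0r.
  by rewrite /coef ffunE.
- move=> y z [c hc] [d hd]; exists (fun S => c S - d S) => W W2.
  rewrite -scaleN1r coefD coefZ mulN1r hc // hd // -sumrB.
  by apply: eq_bigr => S _; rewrite mulrBl.
(* As [z] has no terms of degree below two, only the constant term of [a] affects the product up to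
   degree two. *)
- move=> a z hz; apply: (scale (coef a set0) z) => // W W2.
  rewrite coef_mul (bigD1 set0) ?sub0set //= setD0 inversions0s mul1r.
  rewrite big1 ?addr0 // => S /andP[sSW nS0].
  rewrite (low_small z) ?mulr0 //; apply: leq_trans W2.
  by rewrite -(cardsID S W) (setIidPr sSW) addnC -ltn_subLR // subnn card_gt0.
- move=> a z hz; apply: (scale (coef a set0) z) => // W W2.
  rewrite coef_mul (bigD1 W) //= setDv inversionss0 mul1r mulrC.
  rewrite big1 ?addr0 // => S /andP[sSW nSW].
  rewrite (low_small z S) ?mul0r ?mulr0 //; apply: leq_trans W2.
  by apply: proper_card; rewrite properEneq nSW.
move=> _ [S dS ->]; have S3 := dependent_card dS.
have [cS|nS] := eqVneq #|S| 3%N.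
  exists (fun T => (T == S)%:R) => W _.
  rewrite (bigD1 S) ?dS ?cS //= eqxx mul1r big1 ?addr0 // => T.
  by case/andP=> _ /negPf->; rewrite mul0r.
(* Here [S] has at least four elements, so its boundary starts in degree three and contributes
   nothing. *)
exists (fun=> 0) => W W2; rewrite big1 => [|T _]; last by rewrite mul0r.
apply: contraTeq S3 => /coef_del_basis[i iS eW].
rewrite -leqNgt; move: nS; rewrite (cardsD1 i) iS -eW add1n eqSS => nW.
by rewrite ltn_neqAle nW.
Qed.

(** Left multiples suffice: boundaries of triples are central, so a right factor can be absorbed
    into the coefficient. *)
Lemma quadratic_ideal_span x : ideal_gen (@quadratic_relation K n G) x ->
  exists y : {set 'I_n} -> E,
    x = \sum_(S | dependent G S && (#|S| == 3%N)) y S * del (ebasis K S).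
Proof.
pose span x := exists y : {set 'I_n} -> E,
  x = \sum_(S | dependent G S && (#|S| == 3%N)) y S * del (ebasis K S).
move/(_ span); apply; first split.
- by exists (fun=> 0); rewrite big1 // => S _; rewrite mul0r.
- move=> _ _ [y ->] [z ->]; exists (fun S => y S - z S); rewrite -sumrB.
  by apply: eq_bigr => S _; rewrite mulrBl.
- move=> a _ [y ->]; exists (fun S => a * y S); rewrite mulr_sumr.
  by apply: eq_bigr => S _; rewrite mulrA.
- move=> a _ [y ->]; exists (fun S => y S * a); rewrite mulr_suml.
  apply: eq_bigr => S /andP[_ /eqP S3].
  by rewrite -!mulrA del_central ?S3.
move=> z [/OS_ideal_degree_le2[c hc] hz]; exists (fun S => c S *: (1 : E) : E).
apply: extP => W; rewrite coef_sum.
under eq_bigr do rewrite -ext_scalerAl mul1r coefZ.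
(* Above degree two both sides vanish, being homogeneous of degree two. *)
have [W2|W2] := leqP #|W| 2%N; first exact: hc.
have [->|/hz] := eqVneq (coef z W) 0; last by move=> W2'; rewrite W2' in W2.
rewrite big1 // => S /andP[_ /eqP S3].
have [->|/coef_del_basis[i iS eW]] :=
  eqVneq (coef (del (ebasis K S)) W) 0; first by rewrite mulr0.
by move: S3 W2; rewrite (cardsD1 i) iS -eW add1n => -[->].
Qed.

(** * NBB sets and their dual forms *)

Variable le : rel 'I_n.
Hypothesis le_smallest : forall X, line_closed G X -> X != set0 ->
  exists x : 'I_n, x \in X /\ (forall y : 'I_n, y \in X -> le x y).

Lemma NBB_sub S T : S \in NBB G le -> T \subset S -> T \in NBB G le.
Proof.
rewrite !inE => /forallP hS sTS; apply/forallP => X; apply/implyP => sXT.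
exact: (implyP (hS X)) (subset_trans sXT sTS).
Qed.

(** Were [a] outside [S], it would lie strictly below all of [S], and any point of [S] would make
    [[set a]] proper in [lc G S]; then [S] itself would be bounded below. *)
Lemma NBB_min S a : S \in NBB G le -> S != set0 -> a \in lc G S ->
  (forall y : 'I_n, y \in lc G S -> le a y) -> a \in S.
Proof.
rewrite inE => /forallP/(_ S)/implyP/(_ (subxx S)) + /set0Pn[s sS] aL hmin.
apply: contraNT => aS; apply/existsP; exists a; apply/andP; split.
  rewrite properE sub1set aL; apply/subsetPn; exists s.
    exact: (subsetP (sub_lc S)).
  by rewrite inE; apply: contraNneq aS => <-.
apply/forall_inP => t tS; rewrite hmin ?(subsetP (sub_lc S)) // andbT.
by apply: contraNneq aS => ->.
Qed.

Lemma flag_form_dual S : S \in NBB G le -> exists (F : seq {set 'I_n}) (m : nat),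
  forall T, T \in NBB G le ->
    flag_form F (ebasis K T) = (-1) ^+ m * (T == S)%:R.
Proof.
have [k] := ubnP #|S|; elim: k S => // k IHk S ltSk hS.
have [->|S0] := eqVneq S set0.
  exists [::], 0%N => T _ /=.
  by rewrite coef_basis mul1r eq_sym.
have [a [aL amin]] :
    exists a, a \in lc G S /\ (forall y : 'I_n, y \in lc G S -> le a y).
  apply: le_smallest (lc_closed _) _; have [s sS] := set0Pn _ S0.
  by apply/set0Pn; exists s; apply: (subsetP (sub_lc S)).
have aS := NBB_min hS S0 aL amin.
have [||F [m hF]] := IHk (S :\ a).
- by move: ltSk; rewrite (cardsD1 a) aS.
- exact: NBB_sub hS (subD1set _ _).
exists (lc G S :: F), (#|[set j in S | (j < a)%N]| + m)%N => T hT.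
rewrite flag_form_basis; case: eqP => [eL|nL]; last first.
  by case: eqP nL => [->//|_ _]; rewrite mulr0.
(* The line closure of the empty set is empty, so it cannot contain [a]. *)
have T0 : T != set0.
  apply: contraTneq aL => T0; rewrite eL T0; apply/negP => a0.
  suff /subsetP/(_ a a0) : lc G set0 \subset set0 by rewrite inE.
  by apply: lc_min; last exact: sub0set; apply/forall_inP => i; rewrite inE.
have aT : a \in T.
  by apply: NBB_min hT T0 _ _; rewrite -eL.
(* For [i] other than [a], the set [T :\ i] still contains [a], so it differs from [S :\ a] and its
   term vanishes by induction. *)
rewrite (bigD1 a) //= big1 => [|i /andP[iT nia]]; last first.
  rewrite hF ?(NBB_sub hT (subD1set _ _)) //.
  case: eqP => [e|_]; last by rewrite !mulr0.
  by have := setD11 a S; rewrite -e !inE eq_sym nia aT.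
rewrite hF ?(NBB_sub hT (subD1set _ _)) // addr0.
have [->|nTS] := eqVneq T S; first by rewrite eqxx !mulr1 exprD.
case: eqP => [e|_]; last by rewrite !mulr0.
by case/eqP: nTS; rewrite -(setD1K aT) e setD1K.
Qed.

End Flags.

(** * Linear independence, by applying the dual form of each NBB set to a relation *)

Theorem theorem2p30 (n : nat) (G : matroid 'I_n) (K : comPzRingType)
    (le : rel 'I_n)
    (G_no_loops : no_loops G)
    (G_no_multiple_points : no_multiple_points G)
    (le_refl : reflexive le)
    (le_anti : antisymmetric le)
    (le_trans : transitive le)
    (le_smallest : forall X : {set 'I_n}, line_closed G X -> X != set0 ->
       exists! x : 'I_n, x \in X /\ (forall y : 'I_n, y \in X -> le x y)) :
  lin_indep (NBB G le) (@abar K n G).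
Proof.
move=> c c0 S hS.
have [|F [m hF]] := @flag_form_dual K n G le _ S hS.
  by move=> X lX X0; have [a [ha _]] := le_smallest X lX X0; exists a.
set x : exterior K n := \sum_(T in NBB G le) c T *: ebasis K T.
have pi0 : ext_pi (@quadratic_relation K n G) 0 = 0.
  by rewrite -(scale0r 0) ext_piZ scale0r.
have pix : ext_pi (@quadratic_relation K n G) x = 0.
  rewrite -[RHS]c0 /x (big_morph _ (@ext_piD _ _ _) pi0).
  by apply: eq_bigr => T _; rewrite ext_piZ.
have : flag_form G F x = 0.
  have /ext_piP : ext_pi (@quadratic_relation K n G) x =
    ext_pi (@quadratic_relation K n G) 0 by rewrite pi0.
  rewrite subr0 => /(quadratic_ideal_span G_no_loops G_no_multiple_points).
  move=> [y ->]; rewrite linear_sum big1 // => T /andP[dT /eqP T3].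
  exact: flag_form_ideal.
rewrite /x linear_sum (bigD1 S) //= big1 => [|T /andP[hT /negPf nTS]].
  rewrite linearZ /= hF // eqxx mulr1 addr0.
  (* The remaining sign is its own inverse, so the coefficient vanishes over any commutative
     ring. *)
  move=> /(congr1 (fun u => u * (-1) ^+ m)).
  by rewrite mul0r -mulrA -exprD addnn -signr_odd odd_double mulr1.
by rewrite linearZ /= hF // nTS mulr0 scaler0.
Qed.
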